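(* Let $v_n$ be the number of 021-avoiding ascent sequences of length $n$ that contain no isolated zeros. Then for $n\ge 1$, $$v_n=\sum_{k=1}^{\lfloor (n+1)/3\rfloor}2^{\,n-3k+1}\binom{n-k-1}{2k-2}\,C_{k-1},$$ where $C_m:=\binom{2m}{m}-\binom{2m}{m-1}$ is the Catalan number, and $v_n$ satisfies the defining recurrence $$v_n=v_0v_{n-1}+v_1v_{n-2}+\dots+v_{n-1}v_0$$ for $n\ge 3$ with initial conditions $v_0=1,\ v_1=0,\ v_2=1$.
   Context: An ascent sequence of length $n\ge1$ is a sequence $a_1a_2\dots a_n$ of nonnegative integers with $a_1=0$ and, for each $i\ge 2$, $a_i\le 1+\#\{j\in[1,i-2]: a_j<a_{j+1}\}$; the empty sequence is the ascent sequence of length 0. A sequence avoids 021 if there are no indices $i<j<k$ with $a_i<a_k<a_j$. A run of 0's is a maximal block of consecutive entries all equal to 0; an isolated zero is a run of 0's of length exactly 1. For example, the sequences counted by $v_2$ and $v_3$ are $\{00\}$ and $\{000,001\}$ respectively. The binomial coefficient $\binom{0}{-1}$ is $0$. *)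

(* Defs.v *)
From mathcomp Require Import all_boot all_order all_algebra.
Set Implicit Arguments.
Unset Strict Implicit.
Unset Printing Implicit Defensive.

(* Sequences are indexed from 0 here: the entry a_i of a_1 a_2 ... a_n is
   nth 0 a (i - 1). *)

(* Number of ascents among the first i entries of a, i.e. of positions j with
   j.+1 < i and a_j < a_(j.+1) (0-based). *)
Definition asc (a : seq nat) (i : nat) : nat :=
  count (fun j => nth 0 a j < nth 0 a j.+1) (iota 0 i.-1).

Definition ascent_seq (a : seq nat) : bool :=
  (nth 0 a 0 == 0) &&
  [forall i : 'I_(size a), (0 < i) ==> (nth 0 a i <= 1 + asc a i)].

Definition avoids021 (a : seq nat) : bool :=
  ~~ [exists i : 'I_(size a), exists j : 'I_(size a), exists k : 'I_(size a),
        [&& i < j, j < k, nth 0 a i < nth 0 a k & nth 0 a k < nth 0 a j]].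

(* The block of length l starting at position i is a maximal block of 0's. *)
Definition zero_run (a : seq nat) (i l : nat) : bool :=
  [&& 0 < l, i + l <= size a,
      all (pred1 0) (take l (drop i a)),
      (i == 0) || (nth 0 a i.-1 != 0) &
      (i + l == size a) || (nth 0 a (i + l) != 0)].

Definition has_isolated_zero (a : seq nat) : bool :=
  [exists i : 'I_(size a), zero_run a i 1].

Definition counted (a : seq nat) : bool :=
  [&& ascent_seq a, avoids021 a & ~~ has_isolated_zero a].

(* Restricting the entries to 'I_n loses nothing, by ascent_seq_bound below. *)
Definition v (n : nat) : nat :=
  #|[set a : n.-tuple 'I_n | counted (map val a)]|.

Lemma ascent_seq_bound (a : seq nat) :
  ascent_seq a -> all (fun x => x < size a) a.
Proof.
case/andP=> /eqP a0 /forallP Ha; apply/(all_nthP 0) => i lti.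
case: (posnP i) => [i0|ipos]; first by rewrite i0 a0 -i0 (leq_trans _ lti).
have /implyP/(_ ipos) := Ha (Ordinal lti) => /= H.
apply: leq_ltn_trans H _; rewrite add1n; apply: leq_ltn_trans lti.
have := count_size (fun j => nth 0 a j < nth 0 a j.+1) (iota 0 i.-1).
by rewrite size_iota -ltnS prednK.
Qed.

(* Binomial coefficient with an integer lower index, 0 when it is negative. *)
Definition binz (n : nat) (k : int) : int :=
  match k with Posz j => Posz 'C(n, j) | Negz _ => 0%R end.

Definition catalan (m : nat) : int :=
  (binz (2 * m)%N (Posz m) - binz (2 * m)%N (Posz m - 1))%R.

(* Main.v *)
(** A sequence starting with 0 avoids 021 iff its nonzero entries weakly increase,
    so whether a sequence can be continued depends only on its last entries (no
    zero, one zero or several zeros at the end) and on the slack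
    d = s + 1 - m, where s is the number of ascents and m the largest entry (m = 1
    while there are only zeros).
    Let g = sum_n v_{n+2} x^n, r = (1-x) g and f = g + x^2 g^2.  The generating
    functions of the continuations are geometric in d, namely r^d g after several
    zeros and r^{d-1} f after a nonzero entry; the transition rules hold because
    g = 1 + 2xg + x^3 g^2, i.e. r = 1 + xf.  In terms of V = 1 + x^2 g the
    quadratic equation reads V = 1 - x + x^2 + x V^2, which is the recurrence,
    and its solution g = c(x^3/(1-2x)^2)/(1-2x), with c the Catalan series, is
    the explicit formula.  Power series are replaced by integer polynomials
    satisfying these equations modulo x^N. *)
Require Import Defs.
From mathcomp Require Import all_boot all_order all_algebra.
From mathcomp Require Import ring zify.
Set Implicit Arguments.
Unset Strict Implicit.
Unset Printing Implicit Defensive.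
Import GRing.Theory.

(** * Recursive forms of the three defining conditions *)

(* s is the number of ascents and l the last entry before a. *)
Fixpoint asc_ok s l a :=
  if a is x :: a' then (x <= s.+1) && asc_ok (s + (l < x)) x a' else true.

Fixpoint nondecreasing_nz m a :=
  if a is x :: a' then
    if x == 0 then nondecreasing_nz m a' else (m <= x) && nondecreasing_nz x a'
  else true.

(* p is the entry preceding a; the end of the sequence counts as a nonzero entry. *)
Fixpoint noiso p a :=
  if a is x :: a' then
    ~~ [&& x == 0, p != 0 & head 1 a' != 0] && noiso x a'
  else true.

Lemma asc_cons l x a i : asc [:: l, x & a] i.+2 = (l < x) + asc (x :: a) i.+1.
Proof.
rewrite /asc /= -[1]/(1 + 0) iotaDl count_map; congr (_ + _).
Qed.

Lemma asc_okP s l a :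
  reflect (forall i, i < size a -> nth 0 a i <= (s + asc (l :: a) i.+1).+1)
          (asc_ok s l a).
Proof.
elim: a s l => [|x a IHa] s l /=; first by apply: ReflectT.
apply: (iffP andP) => [[lexs /IHa H] [_|i lti] | H].
- by rewrite /asc /= addn0.
- by rewrite asc_cons addnA; apply: H.
split; first by have := H 0 isT; rewrite /asc /= addn0.
by apply/IHa => i lti; have := H i.+1 lti; rewrite asc_cons addnA.
Qed.

Lemma ascent_seq_cons0 a : ascent_seq (0 :: a) = asc_ok 0 0 a.
Proof.
rewrite /ascent_seq /=; apply/forallP/asc_okP => [H i lti | H [[|i] lti]] //.
  exact: (H (lift ord0 (Ordinal lti))).
exact: H.
Qed.

Lemma nondecreasing_nz_pairwise m a :
  nondecreasing_nz m a = pairwise (fun x y => (y == 0) || (x <= y)) (m :: a).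
Proof.
elim: a m => [|x a IHa] m //=.
case: eqP => [->|/eqP x0] /=; rewrite IHa /=.
  rewrite [all (fun y => _ || (0 <= y)) a](_ : _ = true) //.
  by apply/allP => y _; rewrite leq0n orbT.
case: leqP => //= lemx; case: (boolP (all _ a)) => [/= H|]; last by rewrite andbF.
suff -> : all (fun y => (y == 0) || (m <= y)) a by [].
by apply: sub_all H => y /orP[->|/(leq_trans lemx)->]; rewrite ?orbT.
Qed.

(** An entry followed later by a smaller nonzero one forms 021 with the leading 0; conversely, the
    last entry of a 021 exceeds its first entry and is thus nonzero. *)
Lemma avoids021_cons0 a : avoids021 (0 :: a) = nondecreasing_nz 0 a.
Proof.
rewrite nondecreasing_nz_pairwise; apply/idP/(pairwiseP 0).
  move=> H j k ltj ltk ltjk; apply: contraR H; rewrite negb_or -ltnNge.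
  case: j ltj ltjk => [|j] ltj ltjk; first by rewrite ltn0 andbF.
  case/andP=> k0 ltkj; apply/existsP; exists ord0; apply/existsP.
  exists (Ordinal ltj); apply/existsP; exists (Ordinal ltk).
  by apply/and4P; split=> //; rewrite /= lt0n.
move=> H; apply/existsPn => i; apply/existsPn => j; apply/existsPn => k.
apply/negP => /and4P[ltij ltjk ltik ltkj].
have /orP[/eqP E|] := H j k (ltn_ord j) (ltn_ord k) ltjk.
  by rewrite E in ltik.
by rewrite leqNgt ltkj.
Qed.

Lemma noisoP p a :
  reflect (forall i, i < size a ->
     ~~ [&& nth 0 a i == 0, nth 0 (p :: a) i != 0 & nth 1 a i.+1 != 0])
          (noiso p a).
Proof.
elim: a p => [|x a IHa] p; first by apply: ReflectT.
rewrite /= -nth0; apply: (iffP andP) => [[H0 /IHa H] [_|i lti] | H] //.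
  exact: H.
split; first exact: (H 0).
by apply/IHa => i lti; apply: (H i.+1).
Qed.

Lemma no_isolated_zero a : ~~ has_isolated_zero a = noiso 1 a.
Proof.
have E i : i < size a -> zero_run a i 1 =
    [&& nth 0 a i == 0, nth 0 (1 :: a) i != 0 & nth 1 a i.+1 != 0].
  move=> lti; rewrite /zero_run addn1 lti (drop_nth 0) //= take0 /= andbT.
  congr (_ && (_ && _)); first by case: (i).
  case: eqP => [eqSi|/eqP neSi] /=; first by rewrite [nth 1 _ _]nth_default ?eqSi.
  by rewrite (set_nth_default 0) // ltn_neqAle neSi.
apply/existsPn/noisoP => [H i lti | H i].
  by rewrite -E // (H (Ordinal lti)).
by rewrite E ?H.
Qed.

(** * A left-to-right acceptor for all conditions together *)

Inductive tail := Nonzero | OneZero | Zeros.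

(* m is the largest entry so far, or 1 if only zeros occurred: this is the lower
   bound on the next nonzero entry. *)
Fixpoint accepts m s t a :=
  if a is x :: a' then
    if x == 0 then accepts m s (if t is Nonzero then OneZero else Zeros) a'
    else match t with
    | OneZero => false
    | Nonzero => (m <= x <= s.+1) && accepts x (s + (m < x)) Nonzero a'
    | Zeros => (m <= x <= s.+1) && accepts x s.+1 Nonzero a'
    end
  else if t is OneZero then false else true.

(** In state [Nonzero] the preceding entry is [m] itself, because nonzero entries weakly increase.
    In state [OneZero] the default 1 of [head] rejects the end of the sequence. *)
Lemma acceptsE m s t a : 0 < m ->
  let l := if t is Nonzero then m else 0 in
  accepts m s t a =
    [&& (if t is OneZero then head 1 a == 0 else true),
        asc_ok s l a, nondecreasing_nz m a & noiso l a].
Proof.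
elim: a m s t => [|x a IHa] m s t m0; first by case: t.
rewrite /=; case: (eqVneq x 0) => [->|x0] /=.
  rewrite addn0 IHa //; case: t => //=.
  by rewrite -lt0n m0 negbK /=; case: (head 1 a == 0); rewrite ?andbF.
have IH s' :
    accepts x s' Nonzero a = [&& asc_ok s' x a, nondecreasing_nz x a & noiso x a].
  by rewrite IHa // lt0n.
by case: t; rewrite //= IH ?lt0n ?x0 ?addn1;
  case: (m <= x); case: (x <= s.+1); rewrite ?andbF.
Qed.

Lemma counted_cons x a : counted (x :: a) = (x == 0) && accepts 1 0 OneZero a.
Proof.
rewrite /counted; case: (eqVneq x 0) => [->|x0] /=; last first.
  by rewrite /ascent_seq /= (negPf x0).
rewrite acceptsE // ascent_seq_cons0 avoids021_cons0 no_isolated_zero /=.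
have -> : nondecreasing_nz 0 a = nondecreasing_nz 1 a by elim: a => //= y a ->; case: y.
by rewrite negbK; case: (head 1 a == 0); rewrite ?andbF.
Qed.

(** * Counting continuations by slack *)

(* Number of continuations of length n at slack d: a new nonzero entry after
   zeros leads to any slack in [1, d + 1]; after a nonzero entry it leads to d if
   the entry is repeated and to any slack in [1, d] otherwise. *)
Fixpoint cont n t d : nat :=
  match n, t with
  | 0, OneZero => 0
  | 0, _ => 1
  | n'.+1, Nonzero =>
      cont n' OneZero d + cont n' Nonzero d + \sum_(e < d) cont n' Nonzero e.+1
  | n'.+1, OneZero => cont n' Zeros d
  | n'.+1, Zeros => cont n' Zeros d + \sum_(e < d.+1) cont n' Nonzero e.+1
  end.

Lemma card_tuple_cons (T : finType) n (P : pred (seq T)) :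
  #|[set a : n.+1.-tuple T | P a]| =
    \sum_(x : T) #|[set a : n.-tuple T | P (x :: a)]|.
Proof.
transitivity (\sum_(x : T) \sum_(a : n.-tuple T | P (x :: a)) 1); last first.
  by apply: eq_bigr => x _; rewrite sum1dep_card.
rewrite pair_big_dep -sum1dep_card /=.
rewrite (reindex (fun u : T * n.-tuple T => [tuple of u.1 :: u.2])) //=.
exists (fun a : n.+1.-tuple T => (thead a, [tuple of behead a])).
  by move=> [x a] _ /=; congr (_, _); apply: val_inj.
by move=> a _; rewrite /= -tuple_eta.
Qed.

Lemma sum_slack M m s (F : nat -> nat) : s.+1 < M ->
  \sum_(0 <= x < M | m <= x <= s.+1) F (s.+1 - x) = \sum_(e < s.+2 - m) F e.
Proof.
move=> ltsM; transitivity (\sum_(m <= x < s.+2) F (s.+1 - x)).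
  rewrite [RHS](big_nat_widen _ _ M) // [RHS](big_nat_widenl _ 0) //.
  by apply: eq_bigl => x; rewrite andbC /= ltnS.
rewrite -{1}[m]add0n big_addn big_nat_rev big_mkord.
by apply: eq_bigr => e _; congr F; have := ltn_ord e; lia.
Qed.

(** The number of ascents grows by at most one per entry, so under [s + n < M] the alphabet ['I_M]
    cuts off no admissible entry. *)
Lemma card_accepts M n m s t : 0 < m <= s.+1 -> s + n < M ->
  #|[set a : n.-tuple 'I_M | accepts m s t (map val a)]| = cont n t (s.+1 - m).
Proof.
elim: n m s t => [|n IHn] m s t /andP[m0 lems] ltM.
  rewrite (eq_card (B := fun=> accepts m s t [::])); last first.
    by move=> a; rewrite inE tuple0.
  by case: t => /=; rewrite ?card0 // eq_cardT // -cardT card_tuple.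
have Z t' :
    #|[set a : n.-tuple 'I_M | accepts m s t' (map val a)]| = cont n t' (s.+1 - m).
  by apply: IHn; lia.
rewrite (card_tuple_cons _ (fun a : seq 'I_M => accepts m s t (map val a))) /=.
pose G x := #|[set a : n.-tuple 'I_M | accepts m s t (x :: map val a)]|.
rewrite -(big_mkord xpredT G) {}/G.
(* Repeating [m] after a nonzero entry is no ascent and keeps the slack; an ascent to [x] leaves
   slack [s.+2 - x]. *)
pose B x := match t with
  | Nonzero => cont n Nonzero (if x == m then s.+1 - m else s.+2 - x)
  | OneZero => 0
  | Zeros => cont n Nonzero (s.+2 - x)
  end.
rewrite (eq_bigr (fun x =>
  (if x == 0 then cont n (if t is Nonzero then OneZero else Zeros) (s.+1 - m)
   else 0) + (if m <= x <= s.+1 then B x else 0))); last first.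
  move=> x _ /=; case: (eqVneq x 0) => [->|x0].
    by rewrite leqNgt m0 /= addn0 Z.
  have card_false : #|[set _ : n.-tuple 'I_M | false]| = 0.
    by apply: eq_card0 => a; rewrite inE.
  rewrite /= in IHn; rewrite add0n /B /=; case: (t); rewrite ?if_same //.
  - case: (boolP (m <= x <= s.+1)) => [/andP[lemx lexs]|_] //=.
    rewrite IHn; [|lia|lia].
    by congr (cont n Nonzero _); case: (ltngtP m x) lemx => //= E _; lia.
  case: (boolP (m <= x <= s.+1)) => [/andP[lemx lexs]|_] //=.
  by rewrite IHn //; lia.
rewrite big_split /= -!big_mkcond /= big_nat1_eq.
rewrite ifT; last by lia.
rewrite /B; case: (t) => /=.
- rewrite big_mkcond (eq_bigr (fun x =>
    (if x == m then cont n Nonzero (s.+1 - m) else 0) +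
    (if m.+1 <= x <= s.+1 then cont n Nonzero (s.+1 - x).+1 else 0))); last first.
    move=> x _; case: (ltngtP m x) => [ltmx|//|<-]; last by rewrite lems addn0.
    by rewrite add0n; case: leqP => //= lexs; rewrite subSn.
  rewrite big_split /= -!big_mkcond /= big_nat1_eq ifT; last by lia.
  rewrite addnA (sum_slack m.+1 (fun e => cont n Nonzero e.+1)) ?subSS //.
  by lia.
- by rewrite big1 ?addn0.
congr (_ + _); rewrite -subSn //.
rewrite -(sum_slack m (fun e => cont n Nonzero e.+1) (M := M)); last by lia.
by apply: eq_bigr => x /andP[_ lexs]; rewrite -subSn.
Qed.

Lemma v_cont n : v n.+1 = cont n OneZero 0.
Proof.
rewrite /v (card_tuple_cons _ (fun a : seq 'I_n.+1 => counted (map val a))).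
rewrite big_ord_recl /=.
rewrite big1 => [|i _]; last first.
  by apply: eq_card0 => a; rewrite inE counted_cons.
rewrite addn0 -(subnn 1) -(card_accepts OneZero (M := n.+1)) //.
by apply: eq_card => a; rewrite !inE counted_cons.
Qed.

Local Open Scope ring_scope.

(** * Catalan numbers and their convolution *)

Lemma catalan_bin m : (m + 1)%:Z * catalan m = 'C(2 * m, m)%:Z.
Proof.
rewrite /catalan; case: m => [|m] //.
have -> : m.+1%:Z - 1 = m%:Z by lia.
rewrite /binz mulrBr.
have := mul_bin_left (2 * m.+1) m.
have -> : (2 * m.+1 - m = m.+2)%N by lia.
rewrite addn1 => /(congr1 Posz); rewrite !PoszM; lia.
Qed.

(** Multiplied by m + 1, both sides reduce to central binomial coefficients. *)
Lemma catalanS m : (m + 2)%:Z * catalan m.+1 = (4 * m + 2)%:Z * catalan m.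
Proof.
apply: (mulfI (x := (m + 1)%:Z)); first by lia.
rewrite [RHS]mulrCA catalan_bin.
have -> : (m + 2 = m.+1 + 1)%N by lia.
rewrite catalan_bin.
have := mul_bin_diag (2 * m).+2 m; have := mul_bin_down (2 * m).+1 m.
have -> : (2 * m.+1 = (2 * m).+2)%N by lia.
have -> : ((2 * m).+1 - m = m.+1)%N by lia.
rewrite -!PoszM /= => e1 e2; congr Posz.
have -> : 'C((2 * m).+2, m.+1) = (2 * 'C((2 * m).+1, m))%N.
  by apply/eqP; rewrite -(eqn_pmul2l (ltn0Sn m)) -e2; apply/eqP; lia.
by rewrite mulnCA addn1 -e1; lia.
Qed.

(** Add the weighted sum to its reflection under i -> n - i: the weights i and n - i add up to n. *)
Lemma sum_rev_weighted (F : nat -> int) n :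
  2 * \sum_(i < n.+1) i%:Z * (F i * F (n - i)%N) =
    n%:Z * \sum_(i < n.+1) F i * F (n - i)%N.
Proof.
rewrite mulr2n mulrDl mul1r {2}(reindex_inj rev_ord_inj) -big_split mulr_sumr /=.
apply: eq_bigr => i _; rewrite subSS subKn -1?ltnS //.
have -> : n%:Z = i%:Z + (n - i)%:Z by have := ltn_ord i; lia.
by ring.
Qed.

(* With S = sum C_i C_{n-i} and T = sum i C_i C_{n-i}, symmetry gives 2T = nS and
   catalanS relates T + S to the previous case. *)
Lemma catalan_conv n :
  \sum_(i < n.+1) catalan i * catalan (n - i) = catalan n.+1.
Proof.
elim: n => [|n IHn]; first by rewrite big_ord1.
apply: (mulfI (x := (n.+1 + 2)%:Z)); first by lia.
rewrite catalanS.
set S := \sum_(i < _) _.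
have E1 := sum_rev_weighted catalan n.+1; rewrite -/S in E1.
have E2 := sum_rev_weighted catalan n; rewrite IHn in E2.
have E3 : \sum_(i < n.+2) i%:Z * (catalan i * catalan (n.+1 - i)) + S =
   catalan n.+1 + \sum_(i < n.+1) (4 * i + 2)%:Z * (catalan i * catalan (n - i)).
  rewrite -big_split big_ord_recl /= mul0r add0r subn0 mul1r; congr (_ + _).
  apply: eq_bigr => i _; rewrite /bump /= add1n subSS [RHS]mulrA -catalanS.
  have -> : (i + 2)%:Z = i.+1%:Z + 1 by lia.
  by ring.
have E4 : \sum_(i < n.+1) (4 * i + 2)%:Z * (catalan i * catalan (n - i)) =
  4 * (\sum_(i < n.+1) i%:Z * (catalan i * catalan (n - i))) + 2 * catalan n.+1.
  rewrite -IHn !mulr_sumr -big_split; apply: eq_bigr => i _ /=.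
  by rewrite PoszD PoszM; ring.
rewrite E4 in E3.
set A := \sum_(i < n.+2) _ in E1 E3.
set B := \sum_(i < n.+1) _ in E2 E3.
nia.
Qed.

(** * The solution of the quadratic equation modulo ['X^N] *)

Definition geom2 (N : nat) : {poly int} := \sum_(i < N) (2 *: 'X) ^+ i.

Definition catalan_poly (N : nat) : {poly int} := \poly_(i < N) catalan i.

Lemma catalan_poly_eq N (c := catalan_poly N) :
  exists e, c = 1 + 'X * c ^+ 2 + 'X^N * e.
Proof.
set q := 1 + _; exists (drop_poly N (c - q)).
suff p0 : take_poly N (c - q) = 0.
  by rewrite mulrC -[X in q + X]add0r -p0 poly_take_drop addrC subrK.
apply/polyP => i; rewrite coef_take_poly coef0; case: ltnP => // ltiN.
rewrite /q coefB /c /catalan_poly coefD coef1 coefXM coef_poly ltiN.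
case: i ltiN => [|i] ltiN /=; first by rewrite addr0 subrr.
rewrite add0r expr2 coefM -catalan_conv; apply/eqP; rewrite subr_eq0; apply/eqP.
apply: eq_bigr => j _; rewrite !coef_poly.
by rewrite !ifT //; have := ltn_ord j; lia.
Qed.

Lemma geom2_eq N : (1 - 2 *: 'X) * geom2 N = 1 - 'X^N * (2 ^+ N)%:P.
Proof.
by rewrite /geom2 -[in LHS]opprB mulNr -subrX1 opprB exprZn -mul_polyC mulrC.
Qed.

Lemma coef_geom2_exp N j n : (n < N)%N ->
  (geom2 N ^+ j.+1)`_n = 2 ^+ n * 'C(n + j, j)%:Z.
Proof.
elim: j n => [|j IHj] n.
  move=> ltnN; rewrite expr1 bin0 mulr1 /geom2 coef_sum (bigD1 (Ordinal ltnN)) //=.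
  rewrite exprZn coefZ coefXn eqxx mulr1 big1 ?addr0 // => i /eqP ne.
  rewrite exprZn coefZ coefXn; case: eqP => [E|_]; last by rewrite mulr0.
  by case: ne; apply: val_inj.
(* As [geom2 N] inverts 1 - 2x modulo x^N, this gives Pascal's rule weighted by powers of 2. *)
have E : geom2 N ^+ j.+2 = 2 *: ('X * geom2 N ^+ j.+2) + geom2 N ^+ j.+1
    - 'X^N * ((2 ^+ N)%:P * geom2 N ^+ j.+1).
  apply/eqP; rewrite -subr_eq0; apply/eqP.
  transitivity
    (((1 - 2 *: 'X) * geom2 N - (1 - 'X^N * (2 ^+ N)%:P)) * geom2 N ^+ j.+1).
    by rewrite !exprS -!mul_polyC; ring.
  by rewrite geom2_eq subrr mul0r.
elim: n => [|n IHn] ltnN;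
  rewrite E coefB coefD coefZ coefXM coefXnM ltnN IHj //= subr0.
  by rewrite mulr0 add0r !add0n !binn.
rewrite IHn ?(ltnW ltnN) // -addSnnS (addnS n.+1 j) binS PoszD exprS; ring.
Qed.

Definition avoider_poly (N : nat) : {poly int} :=
  geom2 N * (catalan_poly N \Po ('X ^+ 3 * geom2 N ^+ 2)).

(** Put G = [geom2 N], T = x^3 G^2 and g = G c(T). Modulo x^N, c(T) = 1 + T c(T)^2 becomes (1 - 2x)
    g = 1 + x^3 g^2. *)
Lemma avoider_poly_eq N (g := avoider_poly N) : exists e,
  g = 1 + 2 *: ('X * g) + 'X ^+ 3 * g ^+ 2 + 'X^N * e.
Proof.
have [e /(congr1 (fun p => p \Po ('X ^+ 3 * geom2 N ^+ 2)))] := catalan_poly_eq N.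
rewrite /g /avoider_poly; set T := _ * _ ^+ 2; set c := catalan_poly N \Po T.
rewrite !linearD /= !rmorphM !rmorphXn /= comp_polyX rmorph1 -/c => Ec.
(* The first term comes from T^N, which x^N divides, the second from the truncation of G. *)
exists (('X ^+ 2 * geom2 N ^+ 2) ^+ N * (e \Po T) - (2 ^+ N)%:P * c).
have ET : T ^+ N = 'X^N * ('X ^+ 2 * geom2 N ^+ 2) ^+ N.
  by rewrite -exprMn; congr (_ ^+ N); rewrite /T; ring.
rewrite ET in Ec.
apply/eqP; rewrite -subr_eq0; apply/eqP.
transitivity (((1 - 2 *: 'X) * geom2 N - (1 - 'X^N * (2 ^+ N)%:P)) * c +
  (c - (1 + T * c ^+ 2 + 'X^N * ('X ^+ 2 * geom2 N ^+ 2) ^+ N * (e \Po T)))).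
  by rewrite -!mul_polyC /T; ring.
by rewrite geom2_eq -Ec !subrr mul0r addr0.
Qed.

Lemma coef_avoider_poly N n : (n < N)%N ->
  (avoider_poly N)`_n = \sum_(0 <= i < (n %/ 3).+1)
     2 ^+ (n - 3 * i) * 'C(n - i, 2 * i)%:Z * catalan i.
Proof.
move=> ltnN; rewrite /avoider_poly /catalan_poly poly_def.
rewrite linear_sum mulr_sumr coef_sum /=.
rewrite -(big_mkord xpredT (fun i => (geom2 N *
   ((catalan i *: 'X^i) \Po ('X ^+ 3 * geom2 N ^+ 2)))`_n)).
rewrite (big_cat_nat (n := (n %/ 3).+1)) //=; last by lia.
(* The i-th term is divisible by x^(3i), so it vanishes in degree n when 3i > n. *)
rewrite [X in _ + X]big_nat_cond [X in _ + X]big1 ?addr0 => [|i]; last first.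
  case/andP=> /andP[lti _] _; rewrite linearZ rmorphXn /= comp_polyX.
  rewrite -scalerAr coefZ exprMn -exprM mulrCA coefXnM.
  by case: ifP => [|/negP []]; rewrite ?mulr0 //; lia.
apply: eq_big_nat => i /andP[_ lei].
rewrite linearZ rmorphXn /= comp_polyX -scalerAr coefZ exprMn -exprM mulrCA coefXnM.
case: ifP => [|_]; first by lia.
rewrite -exprM -exprS coef_geom2_exp; last by lia.
by rewrite mulrC; congr (_ * _%:Z * _); congr 'C(_, _); lia.
Qed.

(** * Generating functions of the continuations *)

Section ContinuationSeries.
Variables (N : nat) (g e : {poly int}).
Hypothesis g_eq : g = 1 + 2 *: ('X * g) + 'X ^+ 3 * g ^+ 2 + 'X^N * e.

Let r := (1 - 'X) * g.
Let f := g + 'X ^+ 2 * g ^+ 2.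

(** Since r = 1 + x f modulo x^N, r^d - 1 is x f times a geometric sum. This evaluates the sums over
    slack in [cont]. *)
Lemma coef_exp_r d n : (n.+1 < N)%N ->
  (r ^+ d)`_n.+1 = \sum_(i < d) (r ^+ i * f)`_n.
Proof.
move=> ltnN; have r_eq : r = 1 + 'X * f + 'X^N * e.
  apply/eqP; rewrite -subr_eq0; apply/eqP.
  transitivity (g - (1 + 2 *: ('X * g) + 'X ^+ 3 * g ^+ 2 + 'X^N * e)).
    by rewrite /r /f -mul_polyC; ring.
  by rewrite -g_eq subrr.
have -> : r ^+ d = 1 + 'X * (\sum_(i < d) r ^+ i * f)
                   + 'X^N * (e * \sum_(i < d) r ^+ i).
  by rewrite -mulr_suml -[LHS](subrK 1) subrX1 {1}r_eq; ring.
by rewrite !coefD coef1 coefXM coefXnM ltnN coef_sum add0r addr0.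
Qed.

(** After a nonzero entry the slack is at least 1, hence the shift to [d.+1]. The recursive rules of
    [cont] follow from (1 - x) g = r and (1 - x) f = r + x^2 r g. *)
Lemma coef_cont n d : (n < N)%N ->
  [/\ (cont n Zeros d)%:Z = (r ^+ d * g)`_n,
      (cont n OneZero d)%:Z = ('X * r ^+ d * g)`_n &
      (cont n Nonzero d.+1)%:Z = (r ^+ d * f)`_n].
Proof.
elim: n d => [|n IHn] d ltnN.
  have g0 : g.[0] = 1.
    rewrite g_eq !hornerE expr0n; case: (N) ltnN => // k _.
    by rewrite !hornerE ?expr0n /=; ring.
  rewrite -!horner_coef0 /r /f !hornerE g0 ?expr0n.
  by rewrite !(oppr0, addr0, mulr1, mul0r, mulr0, expr1n); split.
have IH k := IHn k (ltnW ltnN).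
have E k : (\sum_(i < k) cont n Nonzero i.+1)%:Z = (r ^+ k)`_n.+1.
  rewrite coef_exp_r // (big_morph Posz PoszD erefl).
  by apply: eq_bigr => i _; have [_ _ ->] := IH i.
have [Zd _ Nd] := IH d; have [_ Od _] := IH d.+1.
split; rewrite /= ?PoszD ?E ?Zd ?Od ?Nd.
- have Eg : r ^+ d * g = 'X * (r ^+ d * g) + r ^+ d.+1 by rewrite exprSr /r; ring.
  by rewrite [in RHS]Eg coefD coefXM.
- by rewrite -mulrA coefXM.
have Ef : r ^+ d * f =
    'X * ('X * r ^+ d.+1 * g) + 'X * (r ^+ d * f) + r ^+ d.+1.
  by rewrite exprSr /f /r; ring.
by rewrite [in RHS]Ef [RHS]coefD [in RHS]coefD 2!(coefXM _ n.+1).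
Qed.

End ContinuationSeries.

(** * The explicit formula and the recurrence *)

Lemma v_avoider_poly N n : (n < N)%N -> (v n.+2)%:Z = (avoider_poly N)`_n.
Proof.
move=> ltnN; have [e g_eq] := avoider_poly_eq N.
(* A counted sequence of length n + 2 starts with 00, after which the slack is 0, and r^0 g = g. *)
by rewrite v_cont /=; have [-> _ _] := coef_cont g_eq 0 ltnN; rewrite mul1r.
Qed.

Lemma v0 : v 0 = 1%N.
Proof.
rewrite /v (eq_card (B := predT)) ?card_tuple // => a.
rewrite !inE tuple0 /counted /ascent_seq /avoids021 /has_isolated_zero /=.
by apply/and3P; split; [apply/forallP|apply/existsPn|apply/existsPn]; case.
Qed.

Lemma v_explicit n : (0 < n)%N ->
  (v n)%:Z = \sum_(1 <= k < ((n + 1) %/ 3).+1)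
    2 ^+ (n + 1 - 3 * k) * 'C(n - k - 1, 2 * k - 2)%:Z * catalan (k - 1).
Proof.
case: n => [|[|n]] // _; first by rewrite v_cont big_geq.
rewrite (v_avoider_poly (ltnSn n)) coef_avoider_poly // big_add1 /=.
have -> : ((n.+2 + 1) %/ 3 = (n %/ 3).+1)%N by lia.
apply: eq_big_nat => i _.
by congr (_ ^+ _ * 'C(_, _)%:Z * catalan _); lia.
Qed.

Lemma v_rec n : (3 <= n)%N -> v n = (\sum_(0 <= i < n) v i * v (n - 1 - i))%N.
Proof.
move=> le3n; have [e g_eq] := avoider_poly_eq n; set g := avoider_poly n in g_eq.
pose V : {poly int} := 1 + 'X^2 * g.
have vV i : (i <= n)%N -> (v i)%:Z = V`_i.
  rewrite /V coefD coef1 coefXnM => lein.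
  case: i lein => [|[|i]] lein /=; [by rewrite v0|by rewrite v_cont|].
  by rewrite add0r subn2 (v_avoider_poly (N := n)) //; lia.
have V_eq : V = 1 - 'X + 'X^2 + 'X * V ^+ 2 + 'X^n * ('X^2 * e).
  by rewrite {1}/V {1}g_eq /V -mul_polyC; ring.
apply/eqP; rewrite -eqz_nat vV // V_eq.
(* As n is at least 3, 1 - x + x^2 contributes nothing in degree n, and the error term starts only
   in degree n + 2. *)
rewrite !coefD coefN coef1 coefX coefXn coefXM coefXnM.
rewrite ltnn subnn coefXnM addr0 !ifN; [|lia..].
case: n le3n @g g_eq @V vV V_eq => [|[|[|n]]] // _ g g_eq V vV V_eq.
rewrite /= subr0 !add0r expr2 coefM.
rewrite -(big_mkord xpredT (fun i => V`_i * V`_(n.+2 - i))).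
rewrite (big_morph Posz PoszD erefl); apply/eqP; apply: eq_big_nat => i /andP[_ lti].
by rewrite PoszM !vV; [rewrite subn1|lia..].
Qed.

Local Close Scope ring_scope.

Theorem theorem9 :
  (forall n : nat, 1 <= n ->
     Posz (v n) =
       (\sum_(1 <= k < ((n + 1) %/ 3).+1)
          2 ^+ (n + 1 - 3 * k)%N * Posz 'C(n - k - 1, 2 * k - 2)
            * catalan (k - 1)%N)%R)
  /\ (v 0 = 1 /\ v 1 = 0 /\ v 2 = 1)
  /\ (forall n : nat, 3 <= n ->
        v n = \sum_(0 <= i < n) v i * v (n - 1 - i)).
Proof.
split; first exact: v_explicit.
split; last exact: v_rec.
by split; [exact: v0|rewrite !v_cont].
Qed.
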